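(* Let $D$ be a bounded distributive lattice. For all $p,q,r\in\mathbb{Q}\cap[0,1]$ and $a,b\in D$, if $\phi\vdash\psi$ is any of the following rules, then $\phi\models\psi$ (that is, every $\mathbf{\Gamma}$-valued measure $\mu\in\mathcal{M}_{\Gamma}(D)$ with $\mu\models\phi$ satisfies $\mu\models\psi$): (L1) $\mathbb{P}_{\ge q}\,a\vdash\mathbb{P}_{\ge p}\,a$ whenever $p\le q$; (L2) $\mathbb{P}_{\ge q}\,a\vdash\mathbb{P}_{\ge q}\,b$ whenever $a\le b$; (L3) $\mathbf{t}\vdash\mathbb{P}_{\ge0}\,\mathbf{f}^*$, $\mathbf{t}\vdash\mathbb{P}_{\ge q}\,\mathbf{t}^*$, and $\mathbb{P}_{\ge p}\,\mathbf{f}^*\vdash\mathbf{f}$ whenever $p>0$; (L4) $\mathbb{P}_{\ge p}\,a\wedge\mathbb{P}_{\ge q}\,b\vdash\mathbb{P}_{\ge p+q-r}(a\vee b)\vee\mathbb{P}_{\ge r}(a\wedge b)$ whenever $0\le p+q-r\le1$; (L5) $\mathbb{P}_{\ge p+q-r}(a\vee b)\wedge\mathbb{P}_{\ge r}(a\wedge b)\vdash\mathbb{P}_{\ge p}\,a\vee\mathbb{P}_{\ge q}\,b$ whenever $0\le p+q-r\le1$.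
   Context: The totally ordered set $\mathbf{\Gamma}$ consists of formal symbols $\{r^{-}\mid r\in(0,1]\}\cup\{q^{\circ}\mid q\in[0,1]\cap\mathbb{Q}\}$, ordered by: $r^{-}<s^{-}$ iff $r<s$; $p^{\circ}<q^{\circ}$ iff $p<q$; $r^{-}<q^{\circ}$ iff $r\le q$; $q^{\circ}<r^{-}$ iff $q<r$. Two partial operations on $\mathbf{\Gamma}$, $x-y$ and $x\sim y$, are defined exactly when $y\le x$. The first is: $r^{\circ}-s^{\circ}=(r-s)^{\circ}$; $r^{-}-s^{\circ}=(r-s)^{-}$; and both $r^{\circ}-s^{-}$ and $r^{-}-s^{-}$ equal $(r-s)^{\circ}$ if $r-s\in\mathbb{Q}$ and $(r-s)^{-}$ otherwise. The second is $x\sim y=\bigvee\{x-q^{\circ}\mid q\in\mathbb{Q}\cap[0,1],\ y<q^{\circ}\le x\}$ (so $x\sim x=0^{\circ}$, the bottom element). A $\mathbf{\Gamma}$-valued measure on a bounded distributive lattice $D$ (with bounds $0,1$) is a function $\mu\colon D\to\mathbf{\Gamma}$ such that (1) $\mu$ is monotone; (2) $\mu(0)=0^{\circ}$ and $\mu(1)=1^{\circ}$; (3) for all $a,b\in D$, $\mu(a)\sim\mu(a\wedge b)\le\mu(a\vee b)-\mu(b)$ and $\mu(a)-\mu(a\wedge b)\ge\mu(a\vee b)\sim\mu(b)$. $\mathcal{M}_{\Gamma}(D)$ is the set of all such measures. Formulas are built from propositional variables $\mathbb{P}_{\ge p}\,a$ ($a\in D$, $p\in\mathbb{Q}\cap[0,1]$)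 with the connectives $\mathbf{t}$ (true), $\mathbf{f}$ (false), $\wedge,\vee$; $\mathbf{t}^*$ and $\mathbf{f}^*$ denote the top and bottom elements of $D$. Satisfaction for $\mu\in\mathcal{M}_{\Gamma}(D)$: $\mu\models\mathbb{P}_{\ge p}\,a$ iff $\mu(a)\ge p^{\circ}$, extended to the connectives in the usual way. *)

(* Defs.v *)
From HB Require Import structures.
From mathcomp Require Import all_boot all_order all_algebra.
From mathcomp Require Import boolp classical_sets reals.

Set Implicit Arguments.
Unset Strict Implicit.
Unset Printing Implicit Defensive.

Import Order.TTheory GRing.Theory Num.Theory.

Local Open Scope classical_set_scope.
Local Open Scope ring_scope.

Definition rat01 := {q : rat | 0 <= q <= 1}.

Fact rat01_0_subproof : 0 <= (0 : rat) <= 1. Proof. by []. Qed.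
Fact rat01_1_subproof : 0 <= (1 : rat) <= 1. Proof. by []. Qed.
Definition rat01_0 : rat01 := exist _ 0 rat01_0_subproof.
Definition rat01_1 : rat01 := exist _ 1 rat01_1_subproof.

Section Gamma.
Variable R : realType.

Definition real01 := {r : R | 0 < r <= 1}.

Fact real01_1_subproof : 0 < (1 : R) <= 1. Proof. by rewrite ltr01 lexx. Qed.
Definition real01_1 : real01 := exist _ 1 real01_1_subproof.

(* [Gminus r] is r^- and [Gcirc q] is q°. *)
Inductive Gamma : Type :=
| Gminus of real01
| Gcirc of rat01.

Definition Gamma_to_sum (x : Gamma) : real01 + rat01 :=
  match x with Gminus r => inl r | Gcirc q => inr q end.
Definition Gamma_of_sum (x : real01 + rat01) : Gamma :=
  match x with inl r => Gminus r | inr q => Gcirc q end.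
Lemma Gamma_to_sumK : cancel Gamma_to_sum Gamma_of_sum.
Proof. by case. Qed.

HB.instance Definition _ := Choice.copy Gamma (can_type Gamma_to_sumK).

Definition Gamma_lt (x y : Gamma) : bool :=
  match x, y with
  | Gminus r, Gminus s => val r < val s
  | Gcirc p, Gcirc q => val p < val q
  | Gminus r, Gcirc q => val r <= ratr (val q)
  | Gcirc q, Gminus r => ratr (val q) < val r
  end.

Fact Gamma_lt_irr : irreflexive Gamma_lt.
Proof. by case=> x /=; rewrite ltxx. Qed.

Fact Gamma_lt_trans : transitive Gamma_lt.
Proof.
move=> [y|y] [x|x] [z|z] /=; rewrite -?(ltr_rat R) => xy yz.
- exact: lt_trans xy yz.
- exact: le_trans (ltW xy) yz.
- exact: lt_trans xy yz.
- exact: lt_le_trans xy yz.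
- exact: le_lt_trans xy yz.
- exact: le_trans xy (ltW yz).
- exact: lt_trans xy yz.
- exact: lt_trans xy yz.
Qed.

Fact Gamma_display : Order.disp_t. Proof. exact: Order.Disp tt tt. Qed.

HB.instance Definition _ :=
  Order.Lt_isPOrder.Build Gamma_display Gamma Gamma_lt_irr Gamma_lt_trans.

Fact Gamma_le_total : total (<=%O : rel Gamma).
Proof.
move=> x y; rewrite !le_eqVlt orbACA orbC [y == x]eq_sym orbb.
suff: [|| Gamma_lt x y, Gamma_lt y x | x == y] by rewrite orbA.
case: x y => [r|p] [s|q] /=.
- by case: ltgtP => //= /val_inj->.
- by case: leP.
- by case: ltP => //= ->.
- by case: ltgtP => //= /val_inj->.
Qed.

HB.instance Definition _ :=
  Order.POrder_isTotal.Build Gamma_display Gamma Gamma_le_total.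

(* x° if x is rational and x^- otherwise, for x in [0, 1]. *)
Definition Gamma_of_real (x : R) : Gamma :=
  if pselect (exists q : rat, ratr q = x) is left xQ
  then Gcirc (insubd rat01_0 (sval (cid xQ)))
  else Gminus (insubd real01_1 x).

(* The partial operation x - y, made total: the value is meaningful only when
   y <= x, in which case no [insubd] falls back to its default. *)
Definition Gsub (x y : Gamma) : Gamma :=
  match x, y with
  | Gcirc r, Gcirc s => Gcirc (insubd rat01_0 (val r - val s))
  | Gminus r, Gcirc s => Gminus (insubd real01_1 (val r - ratr (val s)))
  | Gcirc r, Gminus s => Gamma_of_real (ratr (val r) - val s)
  | Gminus r, Gminus s => Gamma_of_real (val r - val s)
  end.

(* The partial operation x ~ y, likewise meaningful only when y <= x; the
   supremum of the empty set is the bottom element 0°. *)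
Definition Gsim (x y : Gamma) : Gamma :=
  supremum (Gcirc rat01_0)
    [set Gsub x (Gcirc q) | q in [set q | (y < Gcirc q <= x)%O]].

End Gamma.

Arguments Gcirc {R}.

(* Monotonicity makes all four differences in the last two fields defined. *)
Record Gamma_measure (R : realType) (d : Order.disp_t)
    (D : tbDistrLatticeType d) := GammaMeasure {
  gmeas :> D -> Gamma R;
  gmeas_homo : {homo gmeas : a b / (a <= b)%O};
  gmeas0 : gmeas \bot%O = Gcirc rat01_0;
  gmeas1 : gmeas \top%O = Gcirc rat01_1;
  gmeas_sim_le : forall a b : D,
    (Gsim (gmeas a) (gmeas (a `&` b)) <= Gsub (gmeas (a `|` b)) (gmeas b))%O;
  gmeas_sub_ge : forall a b : D,
    (Gsub (gmeas a) (gmeas (a `&` b)) >= Gsim (gmeas (a `|` b)) (gmeas b))%O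
}.

Inductive formula (d : Order.disp_t) (D : tbDistrLatticeType d) : Type :=
| Fge of rat01 & D
| Ftrue
| Ffalse
| Fand of formula D & formula D
| For of formula D & formula D.

Arguments Fge {d D}.
Arguments Ftrue {d D}.
Arguments Ffalse {d D}.

Fixpoint satisfies (R : realType) (d : Order.disp_t)
    (D : tbDistrLatticeType d) (mu : Gamma_measure R D) (phi : formula D)
    : Prop :=
  match phi with
  | Fge p a => (mu a >= Gcirc p)%O
  | Ftrue => True
  | Ffalse => False
  | Fand phi1 phi2 => satisfies mu phi1 /\ satisfies mu phi2
  | For phi1 phi2 => satisfies mu phi1 \/ satisfies mu phi2
  end.

Definition entails (R : realType) (d : Order.disp_t)
    (D : tbDistrLatticeType d) (phi psi : formula D) : Prop :=
  forall mu : Gamma_measure R D, satisfies mu phi -> satisfies mu psi.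

(* [rule phi psi] is the sequent phi |- psi. *)
Inductive rule (d : Order.disp_t) (D : tbDistrLatticeType d) :
    formula D -> formula D -> Prop :=
| L1 (p q : rat01) (a : D) : val p <= val q ->
    rule (Fge q a) (Fge p a)
| L2 (q : rat01) (a b : D) : (a <= b)%O ->
    rule (Fge q a) (Fge q b)
| L3_bot : rule Ftrue (Fge rat01_0 \bot%O)
| L3_top (q : rat01) : rule Ftrue (Fge q \top%O)
| L3_false (p : rat01) : 0 < val p ->
    rule (Fge p \bot%O) Ffalse
| L4 (p q r : rat01) (a b : D) (pqr : 0 <= val p + val q - val r <= 1) :
    rule (Fand (Fge p a) (Fge q b))
         (For (Fge (exist _ (val p + val q - val r) pqr) (a `|` b)%O)
              (Fge r (a `&` b)%O))
| L5 (p q r : rat01) (a b : D) (pqr : 0 <= val p + val q - val r <= 1) :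
    rule (Fand (Fge (exist _ (val p + val q - val r) pqr) (a `|` b)%O)
               (Fge r (a `&` b)%O))
         (For (Fge p a) (Fge q b)).

(* Main.v *)
(* The adjunction  s° <= x - y  and  q° <= y  imply  (s + q)° <= x  holds for
   the first subtraction, and  s° <= x ~ y  holds as soon as  y < q°  and
   (s + q)° <= x, because x - q° is one of the elements over which the
   supremum ranges; that supremum is genuine since Gamma is a complete chain.
   Chained through the two inequalities of a measure, these facts give (L4)
   and (L5), after monotonicity disposes of the case p <= r. *)
Require Import Defs.
From mathcomp Require Import all_boot all_order all_algebra.
From mathcomp Require Import boolp classical_sets reals.
From mathcomp Require Import lra.

Import Order.TTheory GRing.Theory Num.Theory.

Local Open Scope classical_set_scope.
Local Open Scope ring_scope.

Section Gamma_theory.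
Context {R : realType}.
Implicit Types (x y : Gamma R) (p q s t : rat01).

(** The decoration is forgotten: for rational r, r^- and r° share a value, so [Gval] is monotone but
    does not reflect [<=]. *)
Definition Gval x : R :=
  match x with Gminus r => val r | Gcirc q => ratr (val q) end.

Lemma Gamma_leNlt x y : (x <= y)%O = ~~ Gamma_lt y x.
Proof. by rewrite leNgt. Qed.

Lemma le_circ_circ p q : ((Gcirc p : Gamma R) <= Gcirc q)%O = (val p <= val q).
Proof. by rewrite Gamma_leNlt /= -leNgt. Qed.

Lemma le_circ_minus p (r : real01 R) :
  (Gcirc p <= Gminus r)%O = (ratr (val p) < val r).
Proof. by rewrite Gamma_leNlt /= -ltNge. Qed.

Lemma le_minus_circ (r : real01 R) p :
  (Gminus r <= Gcirc p)%O = (val r <= ratr (val p)).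
Proof. by rewrite Gamma_leNlt /= -leNgt. Qed.

Lemma le_minus_minus (r s : real01 R) :
  (Gminus r <= Gminus s)%O = (val r <= val s).
Proof. by rewrite Gamma_leNlt /= -leNgt. Qed.

Definition le_GammaE :=
  (le_circ_circ, le_circ_minus, le_minus_circ, le_minus_minus).

Lemma Gval_ge0 x : 0 <= Gval x.
Proof. by case: x => [[r /= /andP[/ltW]]|[q /= /andP[]]] //; rewrite ler0q. Qed.

Lemma Gval_le1 x : Gval x <= 1.
Proof.
case: x => [[r /= /andP[]]|[q /= /andP[_ q1]]] //.
by rewrite -(rmorph1 (@ratr R)) ler_rat.
Qed.

Lemma Gval_homo x y : (x <= y)%O -> Gval x <= Gval y.
Proof.
by case: x y => [r|p] [s|q]; rewrite le_GammaE //= ?ler_rat // => /ltW.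
Qed.

Lemma Gval_lt x y : Gval x < Gval y -> (x < y)%O.
Proof. by rewrite !ltNge; apply: contra => /Gval_homo. Qed.

(* With t the supremum of the underlying reals, the supremum of A is t° if A
   contains it and t^- otherwise. *)
Lemma Gamma_supremums_neq0 (A : set (Gamma R)) :
  A !=set0 -> supremums A !=set0.
Proof.
move=> A0; pose B := [set Gval x | x in A]; pose t := sup B.
have B0 : B !=set0 by case: A0 => x Ax; exists (Gval x), x.
have ubB : has_ubound B by exists 1 => _ [x _ <-]; exact: Gval_le1.
have leAt x : A x -> Gval x <= t by move=> Ax; apply: ub_le_sup => //; exists x.
have [[q [Aq qt]]|NA] := pselect (exists q, A (Gcirc q) /\ ratr (val q) = t).
  exists (Gcirc q); split=> [x Ax|u]; last exact.
  by case: x Ax => [r|p] /leAt /=; rewrite le_GammaE -qt ?ler_rat.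
(* If t were 0, any [x] in A would have value 0, hence be 0° because r^- requires r > 0; then A
   would contain 0° with value t, against [NA]. *)
have t01 : 0 < t <= 1.
  apply/andP; split; last by apply: ge_sup => // _ [x _ <-]; exact: Gval_le1.
  case: A0 => x Ax; have := leAt _ Ax; have := Gval_ge0 x.
  rewrite le_eqVlt => /orP[/eqP x0|]; last exact: lt_le_trans.
  rewrite -x0 le_eqVlt => /orP[/eqP t0|//]; case: NA.
  case: x Ax x0 => [[r /= /andP[r0 _]] _ rE|q Aq /= qE].
    by rewrite rE ltxx in r0.
  by exists q; rewrite -qE.
exists (Gminus (exist _ t t01)); split=> [x Ax|u uA].
  case: x Ax => [r|p] Ax; have := leAt _ Ax; rewrite le_GammaE //= le_eqVlt.
  (* Having p° below t^- takes p < t strictly; p = t is the attained case, excluded by [NA]. *)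
  by case/orP => // /eqP pt; case: NA; exists p.
rewrite leNgt; apply/negP => ut.
have ut' : Gval u < t.
  by case: u {uA} ut => [r|p]; rewrite !ltNge le_GammaE.
have [_ [x Ax <-] /Gval_lt] := sup_gt B0 ut'.
by rewrite ltNge (uA _ Ax).
Qed.

Lemma Gval_of_real (v : R) : 0 <= v <= 1 -> Gval (Gamma_of_real v) = v.
Proof.
move=> /andP[v0 v1]; rewrite /Gamma_of_real; case: pselect => [vQ|vNQ] /=.
  case: (cid vQ) => q /= qv; rewrite insubdK // unfold_in /=.
  by rewrite -(ler0q R) -(ler_rat R _ 1) rmorph1 qv v0.
(* In this branch v is irrational, hence nonzero, so [insubd] does not reach its default. *)
rewrite insubdK // unfold_in /= v1 andbT lt_neqAle v0 andbT.
by apply/eqP => v00; apply: vNQ; exists 0; rewrite rmorph0.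
Qed.

(** Subtracting q° keeps the decoration of [x], so the inequality is translated by q, staying strict
    for r^- and weak for r°. *)
Lemma le_circ_Gsub x q s t :
  val t = val s + val q -> (Gcirc t <= x)%O -> (Gcirc s <= Gsub x (Gcirc q))%O.
Proof.
have /andP[s0 _] := valP s; have /andP[q0 _] := valP q => tE.
have tE' : ratr (val t) = ratr (val s) + ratr (val q) :> R.
  by rewrite tE rmorphD.
case: x => r; have /andP[_ r1] := valP r; rewrite !le_GammaE.
  rewrite -(ler0q R) in s0; rewrite -(ler0q R) in q0 => tr.
  rewrite /= in r1 s0 q0 tr tE' *.
  by rewrite insubdK ?unfold_in /=; first lra; apply/andP; split; lra.
move=> tr; rewrite /= in r1 s0 q0 tr tE *.
by rewrite insubdK ?unfold_in /=; first lra; apply/andP; split; lra.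
Qed.

(** When [x] is r^-, a strict t < r is required. If [y] is u^-, it comes from q < u, which makes up
    for passing to values with [Gval]; if [y] is u°, it comes from the difference being itself
    decorated with a minus. *)
Lemma le_circ_of_Gsub x y q s t : val t = val s + val q -> (y <= x)%O ->
  (Gcirc q <= y)%O -> (Gcirc s <= Gsub x y)%O -> (Gcirc t <= x)%O.
Proof.
move=> tE yx qy sxy.
have tE' : ratr (val t) = ratr (val s) + ratr (val q) :> R.
  by rewrite tE rmorphD.
have y0 := Gval_ge0 y; have x1 := Gval_le1 x; have lexy := Gval_homo _ _ yx.
have sub01 : 0 <= Gval x - Gval y <= 1 by apply/andP; split; lra.
have /andP[sub0 sub1] := sub01.
case: x y => [r|r] [u|u] /= in tE tE' yx qy sxy y0 x1 lexy sub01 sub0 sub1 *.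
- have := Gval_homo _ _ sxy; rewrite Gval_of_real //=.
  rewrite !le_GammaE /= in qy *; lra.
- rewrite !le_GammaE in sxy qy yx *; rewrite insubdK in sxy.
    by rewrite -(ler_rat R) /= in sxy qy yx *; lra.
  by rewrite unfold_in /= sub1 subr_gt0 yx.
- have := Gval_homo _ _ sxy; rewrite Gval_of_real //=.
  rewrite !le_GammaE -(ler_rat R) /= in qy *; lra.
- rewrite !le_GammaE /= in sxy qy yx *; rewrite insubdK /= in sxy; first lra.
  by rewrite unfold_in /= subr_ge0 yx -(ler_rat R) rmorphB rmorph1.
Qed.

Lemma le_circ_Gsim x y q s t : val t = val s + val q ->
  (y < Gcirc q)%O -> (Gcirc t <= x)%O -> (Gcirc s <= Gsim x y)%O.
Proof.
move=> tE yq tx.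
have qx : (Gcirc q <= x)%O.
  apply: le_trans tx; rewrite le_circ_circ tE lerDr.
  by case: s {tE} => s /= /andP[].
have Aq : [set Gsub x (Gcirc q) | q in [set q | (y < Gcirc q <= x)%O]]
    (Gsub x (Gcirc q)) by exists q => //=; rewrite yq qx.
apply: le_trans (le_circ_Gsub _ _ _ _ tE tx) _.
(* [supremum] returns its default if no least upper bound exists; existence is what makes it bound
   its set. *)
apply: ge_supremum_Nmem => //.
by apply: Gamma_supremums_neq0; exists (Gsub x (Gcirc q)).
Qed.

End Gamma_theory.

Lemma rat01_sub (p r : rat01) :
  val r <= val p -> exists s : rat01, val p = val s + val r.
Proof.
move=> rp; have s01 : 0 <= val p - val r <= 1.
  have /andP[_ p1] := valP p; have /andP[r0 _] := valP r.
  rewrite /= in rp r0 p1 *.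
  by apply/andP; split; lra.
by exists (Sub (val p - val r) s01); rewrite /= subrK.
Qed.

Section Gamma_measure_theory.
Context {R : realType} {d : Order.disp_t} {D : tbDistrLatticeType d}.
Variable mu : Gamma_measure R D.
Implicit Types (a b : D) (p q r t : rat01).

Lemma measure_join_or_meet a b p q r t : val t = val p + val q - val r ->
  (Gcirc p <= mu a)%O -> (Gcirc q <= mu b)%O ->
  (Gcirc t <= mu (a `|` b))%O \/ (Gcirc r <= mu (a `&` b))%O.
Proof.
move=> tE pa qb.
case: (leP (Gcirc r) (mu (a `&` b)%O)) => [|abr]; [by right|left].
have mub : (mu b <= mu (a `|` b)%O)%O by apply/gmeas_homo/leUr.
(* With s = p - r, the measure inequality carries s° from mu(a) ~ mu(a ∧ b) to mu(a ∨ b) - mu(b),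
   and t = s + q. If p < r, then t < q and mu(b) <= mu(a ∨ b) is enough. *)
case: (leP (val r) (val p)) => rp.
  have [s pE] := rat01_sub _ _ rp.
  apply: (le_circ_of_Gsub _ _ q s t) qb _ => //; first by rewrite tE pE; lra.
  apply: le_trans (gmeas_sim_le mu a b).
  exact: le_circ_Gsim pE abr pa.
by apply: le_trans (le_trans qb mub); rewrite le_circ_circ tE; lra.
Qed.

Lemma measure_left_or_right a b p q r t : val t = val p + val q - val r ->
  (Gcirc t <= mu (a `|` b))%O -> (Gcirc r <= mu (a `&` b))%O ->
  (Gcirc p <= mu a)%O \/ (Gcirc q <= mu b)%O.
Proof.
move=> tE tab rab.
case: (leP (Gcirc q) (mu b)) => [|bq]; [by right|left].
have mua : (mu (a `&` b)%O <= mu a)%O by apply/gmeas_homo/leIl.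
(* The dual route: t = s + q puts s° below mu(a ∨ b) ~ mu(b), hence below mu(a) - mu(a ∧ b), and
   adding r gives p. If p < r, mu(a ∧ b) <= mu(a) is enough. *)
case: (leP (val r) (val p)) => rp.
  have [s pE] := rat01_sub _ _ rp.
  apply: (le_circ_of_Gsub _ _ r s p) rab _ => //.
  apply: le_trans (gmeas_sub_ge mu a b).
  by apply: le_circ_Gsim bq tab; rewrite tE pE; lra.
by apply: le_trans (le_trans rab mua); rewrite le_circ_circ ltW.
Qed.

End Gamma_measure_theory.

Theorem lemma6p1 (R : realType) (d : Order.disp_t) (D : tbDistrLatticeType d)
    (phi psi : formula D) :
  rule phi psi -> entails R phi psi.
Proof.
case=> [p q a pq|q a b ab||q|p p0|p q r a b pqr|p q r a b pqr] mu /=.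
- by apply: le_trans; rewrite le_circ_circ.
- by move=> /le_trans; apply; exact: gmeas_homo.
- by rewrite gmeas0.
- by move=> _; rewrite gmeas1 le_circ_circ; case: q => q /= /andP[].
- by rewrite gmeas0 le_circ_circ leNgt p0.
- by move=> [pa qb]; exact: measure_join_or_meet pa qb.
- by move=> [tab rab]; exact: measure_left_or_right tab rab.
Qed.
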